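(* For all positive integers $k$ and $T_c$ with $T_c\ge p^2$, $N_{p\cdot T_c,\,k+1}=N_{T_c,\,k}$.
   Context: $p$ is a prime with $p>3$ and $n>1$ is an integer with $\gcd(n,p)=\gcd(n,p^2-1)=1$, so the Chebyshev polynomial $T_n$ (first kind: $T_0=1$, $T_1=x$, $T_d=2xT_{d-1}-T_{d-2}$) induces a permutation of $\mathbb{Z}_{p^k}$ for every $k\ge1$. The functional graph $F_{p^k}$ has vertex set $\mathbb{Z}_{p^k}$ and a directed edge from $x$ to $y$ iff $y=T_n(x)\bmod p^k$; it is a disjoint union of directed cycles. $N_{a,k}$ denotes the number of cycles of length $a$ in $F_{p^k}$. *)

(* Defs.v *)
From mathcomp Require Import all_boot all_algebra.
Set Implicit Arguments. Unset Strict Implicit. Unset Printing Implicit Defensive.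
Import GRing.Theory Num.Theory.

Fixpoint cheb_pair (d : nat) (x : int) : int * int :=
  match d with
  | 0 => (1%R, x)
  | d'.+1 => let: (a, b) := cheb_pair d' x in (b, (2 * x * b - a)%R)
  end.

Definition cheb (d : nat) (x : int) : int := (cheb_pair d x).1.

Definition cheb_map (n m : nat) (x : 'I_m) : 'I_m :=
  insubd x (absz (cheb n (x : nat)%:Z %% m%:Z)%Z).

(* N_{a,k}: number of cycles of length a of the functional graph F_{p^k}
   (counted by orbit representatives of the map, each of orbit size a). *)
Arguments cheb_map n m x : clear implicits.

Definition Ncyc (p n a k : nat) : nat :=
  #|[pred x : 'I_(p ^ k) | froots (cheb_map n (p ^ k)) x
                            && (order (cheb_map n (p ^ k)) x == a)]|.

Lemma cheb_rec d x : cheb d.+2 x = (2 * x * cheb d.+1 x - cheb d x)%R.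
Proof. by rewrite /cheb /=; case: (cheb_pair d x). Qed.
Lemma cheb0 x : cheb 0 x = 1%R. Proof. by []. Qed.
Lemma cheb1 x : cheb 1 x = x. Proof. by []. Qed.

(* Main.v *)
Require Import Defs.
From mathcomp Require Import all_boot all_algebra.
From mathcomp Require Import cyclic ring zify.
Set Implicit Arguments. Unset Strict Implicit. Unset Printing Implicit Defensive.
Import GRing.Theory Num.Theory.

(* Since T_(2b+1)(x) - x = 2 (x^2 - 1) U_b(x) U_(b-1)(x), the period of x modulo
   p^k under T_n is governed by the p-adic valuation of Lucas sequences.  By the
   law of apparition p divides U_(d-1)(x) for some d among p, (p-1)/2, (p+1)/2,
   and Euler's theorem gives L < p^2 with n^L = 1 mod p and mod 2d.  Lifting the
   exponent, both for n^L - 1 and for the Lucas sequence, then yields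
     v(T_(n^(Ls))(x) - x) = v(s) + v(T_(n^L)(x) - x)      for all s > 0.
   A period o >= p^2 > L modulo p^k therefore divides some p^i L at which the
   valuation is exactly k, so the period modulo p^(k+1) is a multiple r o with
   p | r; as only p residues lie above x, r = p.  So the points of period p Tc
   modulo p^(k+1) are exactly the lifts of the points of period Tc modulo p^k. *)

(** * Identities between Chebyshev polynomials of the two kinds *)

Section Chebyshev.
Local Open Scope ring_scope.

(* [cheb2 d] is the Chebyshev polynomial of the second kind U_(d-1). *)
Fixpoint cheb2 (d : nat) (x : int) : int :=
  if d is d'.+1 then x * cheb2 d' x + cheb d' x else 0.

Lemma cheb2_0 x : cheb2 0 x = 0. Proof. by []. Qed.

Lemma cheb2S d x : cheb2 d.+1 x = x * cheb2 d x + cheb d x.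
Proof. by []. Qed.

(** Together with [cheb2S] this is one multiplication by x + sqrt(x^2 - 1): [cheb d x] and
    [cheb2 d x] are the coordinates of its d-th power. [cheb_add] is then the law of exponents and
    [cheb_pell] the norm equation. *)
Lemma chebS d x : cheb d.+1 x = x * cheb d x + (x ^+ 2 - 1) * cheb2 d x.
Proof.
elim: d => [|d IHd]; first by rewrite cheb1 cheb0 cheb2_0; ring.
by rewrite cheb_rec cheb2S IHd; ring.
Qed.

Lemma cheb_add i j x :
  cheb (i + j) x = cheb i x * cheb j x + (x ^+ 2 - 1) * (cheb2 i x * cheb2 j x)
  /\ cheb2 (i + j) x = cheb2 i x * cheb j x + cheb i x * cheb2 j x.
Proof.
elim: i => [|i [IHc IHs]]; first by rewrite add0n cheb0 cheb2_0; split; ring.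
by rewrite addSn !chebS !cheb2S IHc IHs; split; ring.
Qed.

Lemma cheb_pell d x : cheb d x ^+ 2 - (x ^+ 2 - 1) * cheb2 d x ^+ 2 = 1.
Proof.
elim: d => [|d IHd]; first by rewrite cheb0 cheb2_0; ring.
by rewrite chebS cheb2S -[RHS]IHd; ring.
Qed.

(** A power of a power: by the norm equation, y = [cheb j x] has y^2 - 1 equal to x^2 - 1 times the
    square of [cheb2 j x], so the s-th power can be expanded in terms of y. *)
Lemma cheb_mul j s x :
  cheb (j * s) x = cheb s (cheb j x)
  /\ cheb2 (j * s) x = cheb2 j x * cheb2 s (cheb j x).
Proof.
elim: s => [|s [IHc IHs]]; first by rewrite muln0 !cheb0 !cheb2_0 mulr0.
have [Ec Es] := cheb_add j (j * s) x.
have pell : cheb j x ^+ 2 - 1 = (x ^+ 2 - 1) * cheb2 j x ^+ 2.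
  by have /eqP := cheb_pell j x; rewrite subr_eq => /eqP ->; ring.
by rewrite mulnS Ec Es IHc IHs chebS cheb2S pell; split; ring.
Qed.

(** Split 2b + 1 as (b + 1) + b and subtract x times the norm equation at b. *)
Lemma cheb_odd_subX b x :
  cheb b.*2.+1 x - x = 2 * (x ^+ 2 - 1) * (cheb2 b.+1 x * cheb2 b x).
Proof.
have -> : b.*2.+1 = (b.+1 + b)%N by lia.
have [-> _] := cheb_add b.+1 b x.
have pell : x = x * (cheb b x ^+ 2 - (x ^+ 2 - 1) * cheb2 b x ^+ 2).
  by rewrite cheb_pell mulr1.
by rewrite [X in _ - X = _]pell chebS cheb2S; ring.
Qed.

(** Modulo q the second term of [chebS] drops out. The factor y in the second claim avoids the
    exponent s - 1. *)
Lemma cheb_modX (q : int) s y : (q %| y ^+ 2 - 1)%Z ->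
  (q %| cheb s y - y ^+ s)%Z /\ (q %| y * cheb2 s y - s%:R * y ^+ s)%Z.
Proof.
move=> qy; elim: s => [|s [IHc IHs]].
  by rewrite cheb0 cheb2_0 expr0 subrr mulr0 mul0r subrr dvdz0.
split.
  have -> : cheb s.+1 y - y ^+ s.+1 = y * (cheb s y - y ^+ s) + (y ^+ 2 - 1) * cheb2 s y.
    by rewrite chebS [y ^+ s.+1]exprS; ring.
  by apply: rpredD; [apply: dvdz_mull | apply: dvdz_mulr].
have -> : y * cheb2 s.+1 y - s.+1%:R * y ^+ s.+1 =
  y * (y * cheb2 s y - s%:R * y ^+ s) + y * (cheb s y - y ^+ s).
  by rewrite cheb2S [y ^+ s.+1]exprS; ring.
by apply: rpredD; apply: dvdz_mull.
Qed.

End Chebyshev.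

(** * Comparison of p-adic valuations and lifting the exponent *)

Section SameValuation.
Variable p : nat.
Hypothesis p_pr : prime p.
Local Open Scope ring_scope.

Lemma one_ndvd : ~~ (p %| 1%R)%Z.
Proof. by rewrite dvdzE absz1 ?absz_nat dvdn1; case: eqP p_pr => // ->. Qed.

Lemma Euclid_dvdzM (a b : int) : (p %| a * b)%Z = (p %| a)%Z || (p %| b)%Z.
Proof. by rewrite !dvdzE abszM Euclid_dvdM. Qed.

Lemma Euclid_dvdzX (a : int) k : (p %| a ^+ k)%Z -> (p %| a)%Z.
Proof.
elim: k => [|k IHk]; first by rewrite expr0 (negPf one_ndvd).
by rewrite exprS Euclid_dvdzM => /orP[].
Qed.

Lemma sqr1_ndvd (y : int) : (p %| y ^+ 2 - 1)%Z -> ~~ (p %| y)%Z.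
Proof.
move=> py; apply/negP => /dvdzP[t yE].
suff : (p %| 1%R)%Z by apply/negP/one_ndvd.
rewrite (_ : 1 = y ^+ 2 - (y ^+ 2 - 1)); last by ring.
by rewrite rpredB // yE expr2 mulrA dvdz_mull.
Qed.

(* [a] and [b] have the same p-adic valuation, possibly infinite. *)
Definition same_val (a b : int) :=
  exists u v : int, [/\ ~~ (p %| u)%Z, ~~ (p %| v)%Z & u * a = v * b].

Lemma same_val_refl a : same_val a a.
Proof. by exists 1, 1; rewrite one_ndvd. Qed.

Lemma same_val_trans b a c : same_val a b -> same_val b c -> same_val a c.
Proof.
case=> u [v [pu pv E]] [u' [v' [pu' pv' E']]].
exists (u' * u), (v * v'); rewrite !Euclid_dvdzM !negb_or pu pv pu' pv'; split=> //.
by rewrite -mulrA E mulrCA E' mulrA.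
Qed.

Lemma same_valM a b c d :
  same_val a b -> same_val c d -> same_val (a * c) (b * d).
Proof.
case=> u [v [pu pv E]] [u' [v' [pu' pv' E']]].
exists (u * u'), (v * v'); rewrite !Euclid_dvdzM !negb_or pu pv pu' pv'; split=> //.
by rewrite mulrACA E E' mulrACA.
Qed.

Lemma same_val_unit a b : ~~ (p %| a)%Z -> ~~ (p %| b)%Z -> same_val a b.
Proof. by move=> pa pb; exists b, a; rewrite mulrC. Qed.

Lemma same_val_cancel c a b : c != 0 -> same_val (c * a) (c * b) -> same_val a b.
Proof.
move=> c0 [u [v [pu pv E]]]; exists u, v; split=> //.
by apply: (mulfI c0); rewrite mulrCA E mulrCA.
Qed.

Lemma same_val_dvd a b k : same_val a b -> ((p ^ k)%N %| a)%Z = ((p ^ k)%N %| b)%Z.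
Proof.
case=> u [v [pu pv E]].
have cop (w : int) : ~~ (p %| w)%Z -> coprimez (p ^ k)%N w.
  by rewrite dvdzE coprimezE /= => pw; rewrite coprimeXl // prime_coprime.
by rewrite -(Gauss_dvdzr _ (cop _ pu)) E Gauss_dvdzr // cop.
Qed.

(* Lifting the exponent: [A (j * s)] has the valuation of [s * A j] as soon as
   this holds for [s] prime to [p] and for [s = p]. *)
Lemma same_val_lift (P : nat -> Prop) (A : nat -> int) :
  (forall j, P j -> P (j * p)%N) ->
  (forall j s, P j -> ~~ (p %| s)%N -> same_val (A (j * s)%N) (A j)) ->
  (forall j, P j -> same_val (A (j * p)%N) (p%:Z * A j)) ->
  forall s j, P j -> (0 < s)%N -> same_val (A (j * s)%N) (s%:Z * A j).
Proof.
move=> Pp A1 Ap; elim/ltn_ind => s IHs j Pj s0.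
have [/dvdnP[t sE]|ps] := boolP (p %| s)%N; last first.
  apply: (same_val_trans (A1 _ _ Pj ps)); rewrite -[X in same_val X _]mul1r.
  apply: same_valM (same_val_refl _); exact: same_val_unit one_ndvd _.
have t0 : (0 < t)%N by move: s0; rewrite sE muln_gt0; case/andP.
have ts : (t < s)%N by rewrite sE ltn_Pmulr // prime_gt1.
(* One factor p of [s] moves into [j], which is why the induction leaves [j] free. *)
have := IHs t ts _ (Pp _ Pj) t0; rewrite -mulnA (mulnC p) -sE => H.
apply: (same_val_trans H); rewrite sE PoszM -mulrA.
by apply: same_valM (same_val_refl _) _; apply: Ap.
Qed.

(** The cofactor of [cheb2 j x] is [cheb2 s y] with y = [cheb j x], and p^2 divides y^2 - 1 by the
    norm equation. By [cheb_modX] the cofactor behaves like s y^(s - 1): modulo p this is a unit if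
    p does not divide s, and modulo p^2 it settles s = p. *)
Lemma cheb2_lift x j s : (p %| cheb2 j x)%Z -> (0 < s)%N ->
  same_val (cheb2 (j * s) x) (s%:Z * cheb2 j x).
Proof.
have sq i : (p %| cheb2 i x)%Z -> ((p ^ 2)%N %| cheb i x ^+ 2 - 1)%Z.
  move=> /dvdzP[t E].
  have -> : cheb i x ^+ 2 - 1 = ((x ^+ 2 - 1) * t ^+ 2) * (p ^ 2)%N.
    have /eqP := cheb_pell i x; rewrite E subr_eq => /eqP ->.
    by rewrite -mulnn PoszM; ring.
  exact: dvdz_mull.
have sq1 i : (p %| cheb2 i x)%Z -> (p %| cheb i x ^+ 2 - 1)%Z.
  by move/sq; apply: dvdz_trans; rewrite dvdzE /= dvdn_exp.
move=> pj s0.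
apply: (@same_val_lift (fun j => is_true (p %| cheb2 j x)%Z) (cheb2^~ x) _ _ _ s j pj s0).
- by move=> i pi; have [_ ->] := cheb_mul i p x; rewrite dvdz_mulr.
- move=> i t pi pt; have [_ ->] := cheb_mul i t x.
  rewrite -[X in same_val _ X]mulr1; apply: same_valM (same_val_refl _) _.
  apply: same_val_unit one_ndvd; apply/negP => pS.
  have [_] := cheb_modX t (sq1 _ pi).
  rewrite rpredBl; last exact: dvdz_mull.
  rewrite Euclid_dvdzM => /orP[|/Euclid_dvdzX].
    by rewrite natz => /(negP pt).
  exact/negP/sqr1_ndvd/sq1.
- move=> i pi; have [_ ->] := cheb_mul i p x; rewrite mulrC.
  apply: same_valM (same_val_refl _).
  have py := sqr1_ndvd (sq1 _ pi).
  have [_ /dvdzP[t E]] := cheb_modX p (sq _ pi).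
  set y := cheb i x in py t E *.
  exists y, (y ^+ p + p%:Z * t); split=> //.
    apply: contra py => H; apply: (@Euclid_dvdzX _ p).
    by rewrite -(addrK (p%:Z * t) (y ^+ p)) rpredB // dvdz_mulr.
  move/eqP: E; rewrite subr_eq => /eqP ->.
  by rewrite -mulnn PoszM natz; ring.
Qed.

End SameValuation.

(* [N] plays the role of sqrt(x^2 - 1), and [x + N] that of the u such that
   x = (u + u^-1) / 2. *)
Lemma ring_cheb (R : pzRingType) (N : R) (x : int) d :
  (N * N = (x ^+ 2 - 1)%:~R)%R ->
  ((x%:~R + N) ^+ d = (cheb d x)%:~R + (cheb2 d x)%:~R * N)%R.
Proof.
move=> NN; elim: d => [|d IHd].
  by rewrite expr0 cheb0 cheb2_0 mul0r addr0.
rewrite exprS IHd chebS cheb2S mulrDl !mulrDr !rmorphD !rmorphM /= -NN.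
have NC : (N * (cheb d x)%:~R = (cheb d x)%:~R * N)%R by apply: commr_int.
have NS : (N * (cheb2 d x)%:~R = (cheb2 d x)%:~R * N)%R by apply: commr_int.
rewrite -[(N * N * _)%R]mulrA NS NC !mulrA NS -!addrA; congr (_ + _)%R.
by rewrite addrA addrC -mulrDl.
Qed.

(** * Law of apparition, and the valuation along iterates of T_n *)

Section ChebyshevModPrime.
Variable p : nat.
Hypothesis p_pr : prime p.
Local Open Scope ring_scope.
Local Notation same_val := (same_val p).

Lemma expr_second_order (e : int) s :
  exists w, (1 + e) ^+ s = 1 + s%:Z * e + e ^+ 2 * w.
Proof.
elim: s => [|s [w IHs]]; first by exists 0; rewrite expr0; ring.
exists (s%:Z + (1 + e) * w); rewrite [_ ^+ s.+1]exprS IHs intS; ring.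
Qed.

(** Doubling clears the denominator of the binomial coefficient s(s - 1)/2. *)
Lemma geometric_second_order (e : int) s :
  exists w, 2 * (\sum_(i < s) (1 + e) ^+ i) =
            2 * s%:Z + s%:Z * (s%:Z - 1) * e + e ^+ 2 * w.
Proof.
elim: s => [|s [w IHs]]; first by exists 0; rewrite big_ord0; ring.
have [v Ev] := expr_second_order e s.
exists (w + 2 * v); rewrite big_ord_recr /= mulrDr IHs Ev intS; ring.
Qed.

(** The cofactor of n^j - 1 is a geometric sum, congruent to s modulo p. For s = p its double is p
    times a number congruent to 2 modulo p, a unit since p is odd. *)
Lemma expr_lift (n : int) j s : odd p -> (p %| n ^+ j - 1)%Z -> (0 < s)%N ->
  same_val (n ^+ (j * s) - 1) (s%:Z * (n ^+ j - 1)).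
Proof.
move=> podd pj s0.
apply: (@same_val_lift p p_pr (fun j => is_true (p %| n ^+ j - 1)%Z)
         (fun j => n ^+ j - 1) _ _ _ s j pj s0) => {pj s0}.
- by move=> i pi; rewrite exprM subrX1 dvdz_mulr.
- move=> i t pi pt; rewrite exprM subrX1 -[X in same_val _ X]mulr1.
  apply: same_valM (same_val_refl p_pr _) _ => //.
  apply: same_val_unit (one_ndvd p_pr); apply: contra pt => pS.
  have : (p %| \sum_(i0 < t) ((n ^+ i) ^+ i0 - 1))%Z.
    by apply: rpred_sum => a _; rewrite subrX1 dvdz_mulr.
  by rewrite sumrB sumr_const card_ord natz rpredBl.
- move=> i /dvdzP[t E]; rewrite exprM subrX1 mulrC.
  apply: same_valM (same_val_refl p_pr _) => //.
  have [w] := geometric_second_order (n ^+ i - 1) p; rewrite addrC subrK => W.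
  exists 2, (2 + p%:Z * ((p%:Z - 1) * t + t ^+ 2 * w)).
  have p2 : ~~ (p %| 2)%Z.
    by rewrite dvdzE /= dvdn_prime2 //; apply: contraL podd => /eqP ->.
  split=> //; last by rewrite W E; ring.
  by apply: contra p2; rewrite rpredDr ?dvdz_mulr.
Qed.

(** Otherwise p would divide both [cheb d x] and [cheb2 d x], against the norm equation. *)
Lemma cheb2S_ndvd x d : (p %| cheb2 d x)%Z -> ~~ (p %| cheb2 d.+1 x)%Z.
Proof.
move=> pd; rewrite cheb2S rpredDl ?dvdz_mull //; apply/negP => pC.
have := one_ndvd p_pr; rewrite -(cheb_pell d x) => /negP; apply.
by apply: rpredB; rewrite expr2 ?mulrA dvdz_mull.
Qed.

(** A 2 by 2 matrix [N] over F_p serves as square root of x^2 - 1, whether or not this is a square.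
    Frobenius gives (x + N)^p = x + N^p; odd powers of [N] are multiples of [N], with zero diagonal,
    so the (0,0) entries give the claim. *)
Lemma cheb_Frobenius x : odd p -> (p %| cheb p x - x)%Z.
Proof.
move=> podd.
pose N : 'M['F_p]_2 :=
  \matrix_(i, j) if (i == 0) && (j == 1) then (x ^+ 2 - 1)%:~R
                 else ((i == 1) && (j == 0))%:R.
have intM k i j : (k%:~R : 'M['F_p]_2) i j = k%:~R *+ (i == j).
  by rewrite -(rmorph_int (@scalar_mx 'F_p 2)) mxE.
have NN : N * N = (x ^+ 2 - 1)%:~R.
  apply/matrixP => i j; rewrite intM mxE !big_ord_recl big_ord0 !mxE.
  by case: i j => [[|[|//]] ?] [[|[|//]] ?];
    rewrite !eqE /= ?(mul0r, mulr0, mul1r, mulr1, add0r, addr0).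
have charM : p \in [pchar 'M['F_p]_2] by rewrite pchar_lalg pchar_Fp.
have NX : N ^+ p = ((x ^+ 2 - 1) ^+ p./2)%:~R * N.
  have NX e : N ^+ e.*2.+1 = ((x ^+ 2 - 1) ^+ e)%:~R * N.
    by rewrite exprSr -mul2n exprM expr2 NN rmorphXn.
  have pE : p./2.*2.+1 = p by rewrite -[RHS]odd_double_half podd.
  by have := NX p./2; rewrite pE.
have := ring_cheb p NN.
rewrite -(pFrobenius_autE charM) pFrobenius_autD_comm; last exact/commr_sym/commr_int.
rewrite pFrobenius_aut_int pFrobenius_autE NX => /matrixP/(_ 0 0).
have N0 k : (k%:~R * N) 0 0 = 0.
  by rewrite mxE !big_ord_recl big_ord0 !intM !mxE !eqE /= !(mul0r, mulr0, addr0).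
rewrite ![(_ + _ * N) 0 0]mxE !N0 !addr0 !intM !mulr1n => E.
by rewrite (dvdz_pcharf (pchar_Fp p_pr)) rmorphB /= -E subrr.
Qed.

(** If p divides x^2 - 1, [cheb_modX] gives the first case. Otherwise p divides the product in
    [cheb_odd_subX] for 2b + 1 = p, where 2 and x^2 - 1 are units. *)
Lemma cheb2_apparition x : odd p ->
  [\/ (p %| cheb2 p x)%Z, (p %| cheb2 p./2 x)%Z | (p %| cheb2 p./2.+1 x)%Z].
Proof.
move=> podd; have p2 : ~~ (p %| 2%R)%Z.
  by rewrite dvdzE /= dvdn_prime2 //; apply: contraL podd => /eqP ->.
have [pD|pD] := boolP (p %| x ^+ 2 - 1)%Z.
  constructor 1; have [_] := cheb_modX p pD.
  rewrite rpredBr; last by rewrite natz dvdz_mulr.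
  by rewrite Euclid_dvdzM // (negPf (sqr1_ndvd p_pr pD)).
have := cheb_Frobenius x podd.
have pE : p = p./2.*2.+1 by rewrite -[LHS]odd_double_half podd.
rewrite [in cheb p x]pE cheb_odd_subX !Euclid_dvdzM //.
rewrite (negPf p2) (negPf pD) /= => /orP[]; first by constructor 3.
by constructor 2.
Qed.

Lemma totient_leq m : (totient m <= m)%N.
Proof.
rewrite totient_count_coprime -[leqRHS]muln1 -{3}(subn0 m) -sum_nat_const_nat.
by apply: leq_sum => i _; apply: leq_b1.
Qed.

(* If n^L = 1 mod M, then d divides (n^L - 1) / 2, so that p divides
   U_((n^L - 1) / 2 - 1)(x). *)
Lemma cheb2_modulus n x : (3 < p)%N -> coprime n p -> coprime n (p ^ 2 - 1) ->
  exists d M, [/\ (p %| cheb2 d x)%Z, (d.*2 %| M)%N, (p %| M)%N, coprime n M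
                & (0 < totient M < p ^ 2)%N].
Proof.
move=> p3 np np1; have podd : odd p by case: (even_prime p_pr) p3 => [->|].
have pE : p = p./2.*2.+1 by rewrite -[LHS]odd_double_half podd.
have [e1 e2] : (p - 1 = p./2.*2)%N /\ (p + 1 = p./2.+1.*2)%N by lia.
have p1E : (p ^ 2 - 1 = (p - 1) * (p + 1))%N by rewrite -(exp1n 2) subn_sqr.
have n1 : coprime n (p - 1) by apply: coprime_dvdr np1; rewrite p1E dvdn_mulr.
have n2 : coprime n (p + 1) by apply: coprime_dvdr np1; rewrite p1E dvdn_mull.
(* phi(pm) = (p - 1) phi(m) <= (p - 1)(p + 1) < p^2. *)
have lt2 m : (m <= p + 1)%N -> coprime p m -> (totient (p * m) < p ^ 2)%N.
  move=> mp pm; rewrite totient_coprime // totient_prime //.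
  have := totient_leq m; nia.
(* [M] is p times 2, p - 1 or p + 1, so it inherits coprimality to [n] from p and p^2 - 1. *)
have [pd|pd|pd] := cheb2_apparition x podd.
- exists p, (p * 2)%N; split=> //; first by rewrite muln2.
  + by rewrite dvdn_mulr.
  + by rewrite coprimeMr np; apply: coprime_dvdr n1; lia.
  + by rewrite totient_gt0 lt2 ?prime_coprime ?gtnNdvd //; lia.
- exists p./2, (p * (p - 1))%N; split=> //; first by rewrite -e1 dvdn_mull.
  + by rewrite dvdn_mulr.
  + by rewrite coprimeMr np.
  + by rewrite totient_gt0 lt2 ?prime_coprime ?gtnNdvd //; lia.
- exists p./2.+1, (p * (p + 1))%N; split=> //; first by rewrite -e2 dvdn_mull.
  + by rewrite dvdn_mulr.
  + by rewrite coprimeMr np.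
  + by rewrite totient_gt0 lt2 ?addn1 ?coprimenS //; lia.
Qed.

(** With n^L = 2b + 1, one has n^(Ls) = 2 b sg + 1 for a geometric sum [sg]. In the factorization
    [cheb_odd_subX] of both differences, 2 (x^2 - 1) is common, the factors of index b + 1 and b sg
    + 1 are units, and [cheb2_lift] compares the remaining ones. *)
Lemma cheb_iter_lift n x : (3 < p)%N -> (1 < n)%N ->
    coprime n p -> coprime n (p ^ 2 - 1) ->
  exists2 L, (0 < L < p ^ 2)%N & forall s, (0 < s)%N ->
    same_val (cheb (n ^ (L * s)) x - x) (s%:Z * (cheb (n ^ L) x - x)).
Proof.
move=> p3 n1 np np1; have podd : odd p by case: (even_prime p_pr) p3 => [->|].
have [d [M [pd dM pM nM L0]]] := cheb2_modulus x p3 np np1.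
exists (totient M) => // s s0; set L := totient M in L0 *.
have nL1 : (1 < n ^ L)%N by rewrite -(exp1n L) ltn_exp2r //; case/andP: L0.
have Mn : (M %| (n ^ L).-1)%N.
  by rewrite -subn1 -eqn_mod_dvd ?(ltnW nL1) //; apply/eqP/Euler_exp_totient.
have /dvdnP[t bE] : (d.*2 %| (n ^ L).-1)%N by apply: dvdn_trans Mn.
pose b := (d * t)%N; pose sg := (\sum_(i < s) (n ^ L) ^ i)%N.
have nLE : (n ^ L = b.*2.+1)%N.
  by rewrite /b doubleMr mulnC -doubleMl doubleMr -bE prednK // ltnW.
have nLsE : (n ^ (L * s) = (b * sg).*2.+1)%N.
  have := predn_exp (n ^ L) s; rewrite -expnM -/sg nLE /= -doubleMl => <-.
  by rewrite prednK // expn_gt0 ltnW.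
have nX e : n%:Z ^+ e = (n ^ e)%N by rewrite -!natz natrX.
(* Lifting the exponent for n^(Ls) - 1, after cancelling 2b = n^L - 1. *)
have sgE : same_val sg s.
  have pn : (p %| n%:Z ^+ L - 1)%Z.
    have -> : n%:Z ^+ L - 1 = (n ^ L).-1%:Z
      by rewrite nX -[X in X%:Z - _ = _](prednK (ltnW nL1)) intS addrC addKr.
    by rewrite dvdzE /= (dvdn_trans pM).
  have := expr_lift podd pn s0; rewrite !nX nLE nLsE.
  have -> : (b * sg).*2.+1%:Z - 1 = b.*2%:Z * sg.
    by rewrite intS addrC addKr doubleMl PoszM.
  have -> : s%:Z * (b.*2.+1%:Z - 1) = b.*2%:Z * s.
    by rewrite intS [_ - 1]addrC addKr mulrC.
  apply: same_val_cancel; rewrite eqz_nat.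
  by apply: contraTneq nL1 => b0; rewrite nLE b0.
have pb : (p %| cheb2 b x)%Z by have [_ ->] := cheb_mul d t x; rewrite dvdz_mulr.
have pB : (p %| cheb2 (b * sg) x)%Z.
  by have [_ ->] := cheb_mul b sg x; rewrite dvdz_mulr.
rewrite nLsE nLE !cheb_odd_subX [X in same_val _ X]mulrCA.
apply: same_valM (same_val_refl p_pr _) _ => //.
rewrite [X in same_val _ X]mulrCA; apply: same_valM => //.
  by apply: same_val_unit; apply: cheb2S_ndvd.
have sg0 : (0 < sg)%N by rewrite /sg; case: (s) s0 => // s' _; rewrite big_ord_recl expn0.
apply: (same_val_trans p_pr (cheb2_lift p_pr pb sg0)).
by apply: same_valM (same_val_refl p_pr _).
Qed.
End ChebyshevModPrime.

(** * Periodic points of a self-map of a finite set *)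

Section FiniteDynamics.
Variables (T : finType) (f : T -> T).

(** Two points with the same image have a common period sr, and both are recovered from that image
    by sr - 1 further iterations. *)
Lemma periodic_inj :
  (forall x, exists2 r, 0 < r & iter r f x = x) -> injective f.
Proof.
move=> per x y fxy; have [r r0 rx] := per x; have [s s0 sy] := per y.
have Ex : iter (s * r) f x = x by rewrite iterM iter_fix.
have Ey : iter (s * r) f y = y by rewrite mulnC iterM iter_fix.
move: Ex Ey; rewrite -(prednK (_ : 0 < s * r)) ?muln_gt0 ?s0 // !iterSr fxy.
by move=> -> ->.
Qed.

Lemma order_dvd_iter x r : injective f -> (order f x %| r) = (iter r f x == x).
Proof.
move=> f_inj; have oK q : iter (q * order f x) f x = x.
  by rewrite iterM iter_fix // iter_order.
apply/idP/eqP => [/dvdnP[q ->] // | rx].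
have: iter (r %% order f x) f x = x.
  by rewrite -[RHS]rx {2}(divn_eq r (order f x)) addnC iterD oK.
move/(congr1 (findex f x)); rewrite findex0 findex_iter ?ltn_mod ?order_gt0 //.
by move=> /eqP.
Qed.

End FiniteDynamics.

(** * Fibres of the reduction from Z/pm to Z/m *)

Section Reduction.
Variables (p m m' : nat).
Hypotheses (m_gt0 : 0 < m) (m'E : m' = p * m).

Definition ord_mod (y : 'I_m') : 'I_m := Ordinal (ltn_pmod y m_gt0).

(** Division by m with remainder splits ['I_m'] as ['I_p] times ['I_m]. *)
Lemma card_ord_mod_fibre (A : {pred 'I_m}) :
  #|[pred y | ord_mod y \in A]| = p * #|A|.
Proof.
have lift_lt (u : 'I_p * 'I_m) : u.1 * m + u.2 < m'.
  rewrite m'E; apply: (@leq_trans (u.1.+1 * m)); last by rewrite leq_mul2r ltn_ord orbT.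
  by rewrite mulSn addnC ltn_add2r.
pose F u : 'I_m' := Ordinal (lift_lt u).
have F_inj : injective F.
  move=> [i a] [j b] /(congr1 val) /= E.
  have Eq : i = j :> nat.
    by have := congr1 (divn^~ m) E; rewrite !divnMDl // !divn_small // !addn0.
  by congr pair; apply: val_inj => //=; move/eqP: E; rewrite Eq eqn_add2l => /eqP.
have FE : F @: setX [set: 'I_p] [set a in A] = [set y | ord_mod y \in A].
  apply/setP => y; rewrite inE; apply/imsetP/idP.
    case=> -[i a]; rewrite !inE /= => aA ->.
    suff -> : ord_mod (F (i, a)) = a by [].
    by apply: val_inj; rewrite /= modnMDl modn_small.
  move=> yA; have y_lt : y %/ m < p by rewrite ltn_divLR // -m'E.
  exists (Ordinal y_lt, ord_mod y); first by rewrite !inE.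
  by apply: val_inj; rewrite /= -divn_eq.
have := card_imset (mem (setX [set: 'I_p] [set a in A])) F_inj.
by rewrite FE cardsX cardsT card_ord !cardsE => <-.
Qed.
End Reduction.

(** * The Chebyshev map on residues and its iterates *)

Section ChebyshevMap.
Local Open Scope ring_scope.

Lemma cheb_congr (q x y : int) d : (q %| x - y)%Z ->
  (q %| cheb d x - cheb d y)%Z /\ (q %| cheb2 d x - cheb2 d y)%Z.
Proof.
move=> qxy; elim: d => [|d [IHc IHs]]; first by rewrite !cheb0 !cheb2_0 !subrr dvdz0.
split.
  have -> : cheb d.+1 x - cheb d.+1 y =
    (x - y) * (cheb d x + (x + y) * cheb2 d x)
    + y * (cheb d x - cheb d y) + (y ^+ 2 - 1) * (cheb2 d x - cheb2 d y).
    by rewrite !chebS; ring.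
  by apply: rpredD; [apply: rpredD; [apply: dvdz_mulr|]|]; rewrite ?dvdz_mull.
have -> : cheb2 d.+1 x - cheb2 d.+1 y =
  (x - y) * cheb2 d x + y * (cheb2 d x - cheb2 d y) + (cheb d x - cheb d y).
  by rewrite !cheb2S; ring.
by apply: rpredD => //; apply: rpredD; [apply: dvdz_mulr | apply: dvdz_mull].
Qed.

(** The default of [insubd] is never taken: m is positive because [x] exists, so the remainder lies
    in range. *)
Lemma val_cheb_map n m (x : 'I_m) :
  (cheb_map n m x : nat)%:Z = (cheb n (x : nat)%:Z %% m%:Z)%Z.
Proof.
have m0 : m%:Z != 0 by rewrite eqz_nat -lt0n (leq_trans _ (ltn_ord x)).
have abs_mod : `|(cheb n (x : nat)%:Z %% m%:Z)%Z|%N%:Z = (cheb n (x : nat)%:Z %% m%:Z)%Z.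
  by rewrite gez0_abs // modz_ge0.
rewrite /cheb_map val_insubd ifT ?abs_mod //.
by rewrite -ltz_nat abs_mod; apply: ltz_mod.
Qed.

Lemma val_iter_cheb_map n m (x : 'I_m) r :
  ((iter r (cheb_map n m) x : nat)%:Z = cheb (n ^ r) (x : nat)%:Z %[mod m%:Z])%Z.
Proof.
elim: r => [|r IHr]; first by rewrite expn0 cheb1.
rewrite iterS val_cheb_map modz_mod expnSr.
have [-> _] := cheb_mul (n ^ r) n (x : nat)%:Z.
by apply/eqP; rewrite eqz_mod_dvd; apply: (cheb_congr _ _).1; rewrite -eqz_mod_dvd IHr.
Qed.

Lemma iter_cheb_map_fix n m (x : 'I_m) r :
  (iter r (cheb_map n m) x == x) = (m %| cheb (n ^ r) (x : nat)%:Z - (x : nat)%:Z)%Z.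
Proof.
rewrite -eqz_mod_dvd -val_iter_cheb_map -val_eqE /= !modz_nat eqz_nat.
by rewrite !modn_small.
Qed.
End ChebyshevMap.

(** * Periods modulo prime powers and the count of cycles *)

Section PrimePower.
Variables p n : nat.
Hypotheses (p_pr : prime p) (p_gt3 : 3 < p) (n_gt1 : 1 < n).
Hypotheses (np : coprime n p) (np21 : coprime n (p ^ 2 - 1)).
Local Notation f k := (cheb_map n (p ^ k)).

Lemma cheb_map_inj k : injective (f k).
Proof.
apply: periodic_inj => x.
have [L /andP[L0 _] lift] := cheb_iter_lift p_pr (x : nat)%:Z p_gt3 n_gt1 np np21.
(* Taking s = p^k in [cheb_iter_lift] makes the difference divisible by p^k, so every point is
   periodic. *)
exists (L * p ^ k); first by rewrite muln_gt0 L0 expn_gt0 prime_gt0.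
have pk0 : 0 < p ^ k by rewrite expn_gt0 prime_gt0.
apply/eqP; rewrite iter_cheb_map_fix (same_val_dvd p_pr _ (lift _ pk0)).
exact: dvdz_mulr.
Qed.

Lemma order_cheb_map k (x : 'I_(p ^ k)) r :
  (order (f k) x %| r) = ((p ^ k)%N %| (cheb (n ^ r) (x : nat)%:Z - (x : nat)%:Z)%R)%Z.
Proof. by rewrite order_dvd_iter ?iter_cheb_map_fix //; apply: cheb_map_inj. Qed.

(** Trades cycles for points, which can be counted along the fibres of reduction. *)
Lemma Ncyc_order_set a k : Ncyc p n a k * a = #|order_set (f k) a|.
Proof.
rewrite -(fcard_order_set (@cheb_map_inj k) (n := a) (a := order_set (f k) a)) //.
rewrite /closed_mem => x y /eqP <-; rewrite !inE /order; congr (_ == _).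
by apply: eq_card => z; rewrite !inE same_fconnect1 //; apply: cheb_map_inj.
Qed.

Section Lift.
Variable k : nat.
Let pk_gt0 : 0 < p ^ k. Proof. by rewrite expn_gt0 prime_gt0. Qed.
Local Notation red := (@ord_mod (p ^ k) (p ^ k.+1) pk_gt0).

Lemma ord_mod_dvd (y : 'I_(p ^ k.+1)) :
  ((p ^ k)%N %| ((y : nat)%:Z - (red y : nat)%:Z)%R)%Z.
Proof. by rewrite -eqz_mod_dvd !modz_nat /= modn_mod. Qed.

(** Periods of [y] and of its reduction become divisibility conditions on the same integer, by p^(k
    + 1) and by p^k. *)
Lemma order_red (y : 'I_(p ^ k.+1)) r : (order (f k) (red y) %| r) =
  ((p ^ k)%N %| (cheb (n ^ r) (y : nat)%:Z - (y : nat)%:Z)%R)%Z.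
Proof.
rewrite order_cheb_map; set x := red y; have yx := ord_mod_dvd y.
have [chyx _] := cheb_congr (n ^ r) yx.
have -> : (cheb (n ^ r) (y : nat)%:Z - (y : nat)%:Z =
  (cheb (n ^ r) (y : nat)%:Z - cheb (n ^ r) (x : nat)%:Z
   - ((y : nat)%:Z - (x : nat)%:Z))
  + (cheb (n ^ r) (x : nat)%:Z - (x : nat)%:Z))%R by ring.
by rewrite [in RHS]rpredDl // rpredB.
Qed.

Lemma order_red_dvd (y : 'I_(p ^ k.+1)) : order (f k) (red y) %| order (f k.+1) y.
Proof.
have := dvdnn (order (f k.+1) y); rewrite order_cheb_map order_red.
by apply: dvdz_trans; rewrite dvdzE /= dvdn_exp2l.
Qed.

Lemma red_iter (y : 'I_(p ^ k.+1)) r :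
  red (iter r (f k.+1) y) = iter r (f k) (red y).
Proof.
apply: val_inj => /=; set z := iter r _ y.
suff /eqP : ((z : nat)%:Z = (iter r (f k) (red y) : nat)%:Z %[mod (p ^ k)%N])%Z.
  by rewrite !modz_nat eqz_nat [X in _ == X]modn_small // => /eqP.
rewrite val_iter_cheb_map; apply/eqP; rewrite eqz_mod_dvd.
have zE : ((p ^ k)%N %| ((z : nat)%:Z - cheb (n ^ r) (y : nat)%:Z)%R)%Z.
  have := val_iter_cheb_map n y r => /eqP; rewrite eqz_mod_dvd.
  by apply: dvdz_trans; rewrite dvdzE /= dvdn_exp2l.
have [H _] := cheb_congr (n ^ r) (ord_mod_dvd y).
by rewrite -(rpredDl _ zE) addrA subrK in H.
Qed.

(** The orbit of [y] lies above that of its reduction, with p points in each fibre. *)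
Lemma order_red_leq (y : 'I_(p ^ k.+1)) :
  order (f k.+1) y <= p * order (f k) (red y).
Proof.
rewrite {2}/order -(card_ord_mod_fibre pk_gt0 (expnS p k)).
apply/subset_leq_card/subsetP => z /iter_findex <-.
by rewrite !inE red_iter fconnect_iter.
Qed.

Lemma order_lift (y : 'I_(p ^ k.+1)) : p ^ 2 <= order (f k) (red y) ->
  order (f k.+1) y = p * order (f k) (red y).
Proof.
set o := order _ (red y) => po.
have /dvdnP[r oE] := order_red_dvd y; rewrite -/o in oE.
have o0 : 0 < o by apply: order_gt0.
have r0 : 0 < r by have := order_gt0 (f k.+1) y; rewrite oE muln_gt0 => /andP[].
suff /dvdn_leq : p %| r.
  move=> /(_ r0) pr; apply/eqP; rewrite eqn_leq order_red_leq oE.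
  by rewrite leq_mul2r pr orbT.
apply/negPn/negP => pr.
have [L /andP[L0 Lp] lift] := cheb_iter_lift p_pr (y : nat)%:Z p_gt3 n_gt1 np np21.
set c := (cheb (n ^ L) _ - _)%R in lift.
(* Since o >= p^2 > L, o cannot divide L; hence the valuation [j] of [c] is below k, and L p^(k - j)
   is a period modulo p^k. *)
have pkc : ~~ ((p ^ k)%N %| c)%Z.
  by rewrite -order_red; apply/negP => /(dvdn_leq L0); lia.
have c0 : 0 < `|c| by rewrite absz_gt0; apply: contraNneq pkc => ->; apply: dvdz0.
pose j := logn p `|c|.
have jk : j < k by move: pkc; rewrite dvdzE pfactor_dvdn // -ltnNge.
have pi0 : 0 < p ^ (k - j) by rewrite expn_gt0 prime_gt0.
have oL : o %| L * p ^ (k - j).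
  rewrite order_red (same_val_dvd p_pr _ (lift _ pi0)) dvdzE abszM /=.
  by rewrite pfactor_dvdn ?muln_gt0 ?pi0 // lognM // pfactorK // subnK // ltnW.
(* At this multiple of L the valuation is (k - j) + j = k because p does not divide [r], whereas
   being a period modulo p^(k + 1) requires k + 1. *)
have : order (f k.+1) y %| L * (r * p ^ (k - j)).
  by rewrite oE mulnCA dvdn_pmul2l.
have rpi0 : 0 < r * p ^ (k - j) by rewrite muln_gt0 r0.
rewrite order_cheb_map (same_val_dvd p_pr _ (lift _ rpi0)) dvdzE abszM /=.
rewrite pfactor_dvdn //; last by rewrite muln_gt0 rpi0.
have r_log : logn p r = 0 by rewrite lognE (negPf pr) !andbF.
by rewrite lognM // lognM // r_log pfactorK // subnK ?ltnn // ltnW.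
Qed.

Lemma Ncyc_lift a : p ^ 2 <= a -> Ncyc p n (p * a) k.+1 = Ncyc p n a k.
Proof.
move=> pa; have p0 := prime_gt0 p_pr.
have a0 : 0 < a by apply: leq_trans pa; rewrite expn_gt0 p0.
have pa0 : 0 < p * a by rewrite muln_gt0 p0.
apply/eqP; rewrite -(eqn_pmul2r pa0) Ncyc_order_set mulnCA Ncyc_order_set.
rewrite -(card_ord_mod_fibre pk_gt0 (expnS p k)); apply/eqP/eq_card => y.
rewrite !inE; apply/eqP/eqP => [oy|ox]; last by rewrite order_lift ox.
(* Hence the reduction of [y] also has period at least p^2, as [order_lift] requires. *)
have ax : a <= order (f k) (red y).
  by rewrite -(leq_pmul2l p0) -oy order_red_leq.
by apply/eqP; rewrite -(eqn_pmul2l p0) -oy -order_lift // (leq_trans pa).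
Qed.
End Lift.
End PrimePower.

Theorem theorem2 (p n : nat) :
  prime p -> 3 < p -> 1 < n -> coprime n p -> coprime n (p ^ 2 - 1) ->
  forall k Tc : nat, 0 < k -> 0 < Tc -> p ^ 2 <= Tc ->
  Ncyc p n (p * Tc) k.+1 = Ncyc p n Tc k.
Proof. by move=> p_pr p_gt3 n_gt1 np np21 k Tc _ _; apply: Ncyc_lift. Qed.
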